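(* Let $X$ be a Polish space with a Borel probability measure $\mu$, let $c:X^n\to[0,\infty]$ be a lower semi-continuous Borel measurable function, and consider $(MK)$ with all $n$ marginals equal to $\mu$. Let $\mathcal G$ be a set of $\mu$-measure preserving maps on $X$ such that \[c(x_1,\dots,x_n)=c(Ux_1,\dots,Ux_n)\qquad\forall(x_1,\dots,x_n)\in X^n,\ \forall U\in\mathcal G,\] and such that $U\circ R=R\circ U$ for all $U,R\in\mathcal G$. Let $\sigma:X^n\to X^n$ be a permutation (of the coordinates) such that $c\circ\sigma=c$. If $\mathcal G$ is countable, then $(MK)$ has a solution $\bar\gamma$ such that $\bar\gamma=\sigma\#\bar\gamma$ and $\bar\gamma=(U,\dots,U)\#\bar\gamma$ for all $U\in\mathcal G$. Furthermore, if $X$ is a metric space and $\mathcal G$ equipped with the point-wise topology on $X$ is separable, then the countability assumption on $\mathcal G$ is not required.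
   Context: $\Pi(\mu,\dots,\mu)$ is the set of Borel probability measures on $X^n$ all of whose $n$ marginals equal $\mu$. The Monge-Kantorovich problem $(MK)$ is $\inf\{\int_{X^n}c\,d\pi;\ \pi\in\Pi(\mu,\dots,\mu)\}$; a solution is an element of $\Pi(\mu,\dots,\mu)$ attaining the infimum (which may be $+\infty$). $T\#\mu$ denotes push-forward, and $(U,\dots,U)$ denotes the map $(x_1,\dots,x_n)\mapsto(Ux_1,\dots,Ux_n)$. A map $T:X\to X$ is $\mu$-measure preserving if $T\#\mu=\mu$, i.e. for all $f\in\mathcal L^1(\mu)$ (the $\mu$-integrable functions), $f\circ T\in\mathcal L^1(\mu)$ and $\int_X f\,d\mu=\int_X f\circ T\,d\mu$. Point-wise topology: this is the topology of point-wise convergence on $X$ induced by the metric $d$ of $X$; a sequence $\{U_k\}_{k\in\mathbb N}\subset\mathcal G$ converges to $U\in\mathcal G$ if and only if $\lim_{k\to\infty}d(U_kx,Ux)=0$ for every $x\in X$. The set $\mathcal G$ equipped with the point-wise topology is called separable if it has a dense countable subset. *)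

(* Defs.v *)
From HB Require Import structures.
From mathcomp Require Import all_boot all_order all_algebra all_fingroup.
From mathcomp Require Import all_classical all_reals all_analysis.
From mathcomp Require Import measurable_realfun.

Set Implicit Arguments.
Unset Strict Implicit.
Unset Printing Implicit Defensive.

Import Order.TTheory GRing.Theory Num.Theory.
Import numFieldNormedType.Exports.

Local Open Scope classical_set_scope.
Local Open Scope ring_scope.

Section Polish.
Context {R : realType}.

Definition is_metric (X : Type) (d : X -> X -> R) : Prop :=
  [/\ forall x, d x x = 0,
      forall x y, d x y = 0 -> x = y,
      forall x y, d x y = d y x &
      forall x y z, d x z <= d x y + d y z].

Definition metrizes (X : topologicalType) (d : X -> X -> R) : Prop :=
  is_metric d /\
  forall (x : X) (A : set X),
    nbhs x A <-> exists2 e, 0 < e & [set y | d x y < e] `<=` A.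

Definition complete_metric (X : Type) (d : X -> X -> R) : Prop :=
  forall u : nat -> X,
    (forall e, 0 < e ->
       exists N, forall i j, (N <= i)%N -> (N <= j)%N -> d (u i) (u j) < e) ->
    exists l, forall e, 0 < e ->
       exists N, forall i, (N <= i)%N -> d (u i) l < e.

End Polish.

Definition separable_space (X : topologicalType) : Prop :=
  exists2 D : set X, countable D & dense D.

Definition polish (R : realType) (X : topologicalType) : Prop :=
  separable_space X /\
  exists2 d : X -> X -> R, metrizes d & complete_metric d.

(* Borel sets are attached to a copy of the carrier, so [borel X] and [X] are
   convertible but carry different structures. *)
Notation borel X := (g_sigma_algebraType (@open X)).

(* X^n with its product topology; [borel (npow X n)] is thus generated by the
   open sets of the product, not by the measurable rectangles. *)
Notation npow X n := {ptws 'I_n -> X}.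

(* Values of a measure on non-measurable sets are irrelevant, so measures have
   to be compared on measurable sets only. *)
Definition eq_measure (d : measure_display) (T : measurableType d)
    (R : realType) (m1 m2 : set T -> \bar R) : Prop :=
  forall A, measurable A -> m1 A = m2 A.

Definition measure_preserving (d : measure_display) (T : measurableType d)
    (R : realType) (mu : {measure set T -> \bar R}) (f : T -> T) : Prop :=
  measurable_fun [set: T] f /\ eq_measure (pushforward mu f) mu.

Section MongeKantorovich.
Context {R : realType} {X : ptopologicalType} {n : nat}.

Definition marginal (pi : probability (borel (npow X n)) R) (i : 'I_n) :
    set (borel X) -> \bar R :=
  pushforward pi ((fun x => x i) : borel (npow X n) -> borel X).

Definition couplings (mu : probability (borel X) R) :
    set (probability (borel (npow X n)) R) :=
  [set pi | forall i, eq_measure (marginal pi i) mu].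

Definition MK_cost (c : npow X n -> \bar R)
    (pi : probability (borel (npow X n)) R) : \bar R :=
  (\int[pi]_x c x)%E.

Definition MK_value (mu : probability (borel X) R) (c : npow X n -> \bar R) :
    \bar R :=
  ereal_inf [set MK_cost c pi | pi in couplings mu].

Definition MK_solution (mu : probability (borel X) R) (c : npow X n -> \bar R)
    (pi : probability (borel (npow X n)) R) : Prop :=
  couplings mu pi /\ MK_cost c pi = MK_value mu c.

Definition diag_map (U : X -> X) : npow X n -> npow X n :=
  fun x i => U (x i).

Definition perm_coord (s : {perm 'I_n}) : npow X n -> npow X n :=
  fun x i => x (s i).

Definition invariant_under (pi : probability (borel (npow X n)) R)
    (f : npow X n -> npow X n) : Prop :=
  eq_measure (pushforward pi (f : borel (npow X n) -> borel (npow X n))) pi.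

End MongeKantorovich.

(* Separability of G for the topology it inherits from {ptws X -> X}. *)
Definition ptws_separable (X : topologicalType) (G : set (X -> X)) : Prop :=
  exists D : set {ptws X -> X},
    [/\ countable D, D `<=` G & G `<=` closure D].

(* {ptws X -> X} only sees the topology of X; when that topology comes from a
   metric d, convergence of sequences in it is pointwise d-convergence. *)
Lemma cvg_ptws_metric (R : realType) (X : topologicalType) (d : X -> X -> R)
    (u : nat -> X -> X) (U : X -> X) :
  metrizes d ->
  ((u @ \oo --> (U : {ptws X -> X})) <->
   forall x, d (u k x) (U x) @[k --> \oo] --> (0 : R)).
Proof.
move=> [[d0 _ dC dT] dN].
have dge0 x y : 0 <= d x y.
  have := dT x y x; rewrite d0 (dC y x) -mulr2n => h.
  by rewrite -(@pmulrn_lge0 _ _ 2).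
rewrite (_ : (u @ \oo --> (U : {ptws X -> X})) <->
   forall x, (fun k => u k x) @ \oo --> U x); last first.
  split=> [h x|h]; first exact: cvg_comp h (@proj_continuous _ (fun=> X) x U).
  apply/cvg_sup => x; apply/cvg_image.
    by rewrite eqEsubset; split=> // y _; exists (fun=> y).
  move=> A /h hA; exists ((fun f : X -> X => f x) @^-1` A) => //.
  by rewrite image_preimage// eqEsubset; split=> // y _; exists (fun=> y).
split=> h x.
  apply/cvgrPdist_lt => e e0.
  have : nbhs (U x) [set y | d (U x) y < e] by apply/dN; exists e.
  move/(h x); rewrite nbhs_filterE; apply: (@filterS _ \oo _) => k /=.
  by rewrite sub0r normrN ger0_norm// dC.
move=> A /dN[e e0 eA].
have /cvgrPdist_lt/(_ e e0) := h x.
rewrite nbhs_filterE; apply: (@filterS _ \oo _) => k /=.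
by rewrite sub0r normrN ger0_norm// => hk; apply: eA; rewrite /= dC.
Qed.

(* Main.v *)
(* Take an ultrafilter on the couplings of mu containing, for all finite sets of
   symmetries f (the maps (U, ..., U) and the permutation), all e > 0 and all t
   above the value of (MK), the set of couplings p of cost at most t with
   |p (f^-1 A) - p A| <= e for all Borel A. Such p are obtained from a coupling
   of cost at most t by iterated Cesaro averages, since the symmetries commute
   and preserve the cost. The limit L of p A along the ultrafilter is finitely
   additive on the Borel sets of X^n. As L has marginals mu, which is tight and
   regular, L is countably additive on the algebra of sets that are regular for
   L, and extends from it to a Borel probability gamma that agrees with L on
   all boxes with Borel sides. So gamma is a coupling, and it is invariant
   although the maps in G need not be continuous. Finally gamma V <= L V for
   open V, so that the layer-cake formula bounds the cost of gamma. *)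

Require Import Defs.
From HB Require Import structures.
From mathcomp Require Import all_boot all_order all_algebra all_fingroup.
From mathcomp Require Import all_classical all_reals all_analysis.
From mathcomp Require Import measurable_realfun.
From mathcomp Require Import lra.

Set Implicit Arguments.
Unset Strict Implicit.
Unset Printing Implicit Defensive.

Import Order.TTheory GRing.Theory Num.Theory.
Import numFieldNormedType.Exports.

Local Open Scope classical_set_scope.
Local Open Scope ring_scope.

(** * Regularity and tightness on Polish spaces *)

Lemma measurable_open (X : ptopologicalType) (A : set X) :
  open A -> measurable (A : set (borel X)).
Proof. exact: sub_sigma_algebra. Qed.

Lemma measurable_closed (X : ptopologicalType) (A : set X) :
  closed A -> measurable (A : set (borel X)).
Proof.
move=> cA; rewrite -[A]setCK; apply: (@measurableC _ (borel X)).
by apply: measurable_open; exact: closed_openC.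
Qed.

Section finite_measure.
Context (d : measure_display) (T : measurableType d) (R : realType).
Variable mu : {finite_measure set T -> \bar R}.

(** Continuity from above for a finite measure; the strict bound on the intersection is what makes a
    single index suffice. *)
Lemma nonincreasing_measure_lt (F : (set T)^nat) (e : R) :
  (forall i, measurable (F i)) -> nonincreasing_seq F ->
  (mu (\bigcap_i F i) < e%:E)%E -> exists N, (mu (F N) < e%:E)%E.
Proof.
move=> mF ndF mue.
have mI : measurable (\bigcap_i F i) by exact: bigcapT_measurable.
have : mu \o F @ \oo --> mu (\bigcap_i F i).
  by apply: nonincreasing_cvg_mu => //; rewrite ltey_eq fin_num_measure.
move=> cF; apply: contrapT => /forallNP eF; move: mue; apply/negP; rewrite -leNgt.
rewrite -(cvg_lim _ cF)//; apply: lime_ge; first by apply/cvg_ex; eexists; exact: cF.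
by apply: nearW => N /=; rewrite leNgt; apply/negP; exact: eF.
Qed.

End finite_measure.

(** Stated for any set function, so as to serve both for the probability [mu] and for the finitely
    additive limit content on the product. *)
Definition closed_open_approx (R : realType) (X : topologicalType)
    (mu : set X -> \bar R) (A : set X) :=
  forall e : R, 0 < e -> exists F O : set X,
    [/\ closed F, open O, F `<=` A, A `<=` O & (mu (O `\` F) <= e%:E)%E].

Lemma closed_open_approxC (R : realType) (X : topologicalType)
    (mu : set X -> \bar R) (A : set X) :
  closed_open_approx mu A -> closed_open_approx mu (~` A).
Proof.
move=> hA e e0; have [F [V [cF oV FA AV muVF]]] := hA e e0;
exists (~` V), (~` F); split.
- exact: open_closedC.
- exact: closed_openC.
- exact: subsetC.
- exact: subsetC.
- by rewrite setDE setCK setIC -setDE.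
Qed.

Section metrizable.
Context {R : realType} {X : ptopologicalType} (d : X -> X -> R).
Hypothesis dX : metrizes d.

Lemma metrizes_nbhs x (A : set X) : nbhs x A ->
  exists2 e : R, 0 < e & [set y | d x y < e] `<=` A.
Proof. by move/(dX.2 x A). Qed.

Lemma open_metric_ball x e : open [set y | d x y < e].
Proof.
have [[d0 _ dC dT] dN] := dX.
rewrite openE => y /= xy; apply/dN; exists (e - d x y); first by rewrite subr_gt0.
by move=> z /= yz; have := dT x y z; lra.
Qed.

Lemma closed_metric_ball x e : closed [set y | d x y <= e].
Proof.
have [[d0 _ dC dT] dN] := dX.
rewrite -[X in closed X]setCK; apply: open_closedC; rewrite openE => y /= xy.
apply/dN; exists (d x y - e); first by move/negP : xy; rewrite -ltNge; lra.
by move=> z /= yz; have := dT x z y; rewrite (dC z y) => h xz; lra.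
Qed.

(** The complement is the union of the open balls of radius [e] centred outside [O]. *)
Lemma closed_metric_thinning (O : set X) e :
  closed [set x | forall y, d x y < e -> O y].
Proof.
have [[d0 _ dC dT] dN] := dX.
rewrite (_ : mkset _ = ~` \bigcup_(y in ~` O) [set x | d y x < e]).
  by apply: open_closedC; apply: bigcup_open => y _; exact: open_metric_ball.
apply/seteqP; split=> x /=.
  by move=> xO [y Oy /= yx]; apply: Oy; apply: xO; rewrite dC.
move=> xO y xy; apply: contrapT => Oy; apply: xO; exists y => //=.
by rewrite dC.
Qed.

Section regularity.
Variable mu : probability (borel X) R.

(** The thinnings of [O] by 1/(N+1) are closed and increase to [O], so continuity from above applies
    to what they leave out; the outer set is [O] itself. *)
Lemma closed_open_approx_open (O : set X) :
  open O -> closed_open_approx mu O.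
Proof.
move=> oO e e0.
have [[d0 _ dC dT] dN] := dX.
pose F N := [set x | forall y, d x y < N.+1%:R^-1 -> O y].
have FO N : F N `<=` O by move=> x; apply; rewrite d0 invr_gt0.
have cF N : closed (F N) by exact: closed_metric_thinning.
have [||//|N hN] := @nonincreasing_measure_lt _ _ _ mu (fun N => O `\` F N) e.
- move=> N; apply: (@measurableD _ (borel X)); first exact: measurable_open.
  exact: measurable_closed.
- apply/nonincreasing_seqP => N; apply/subsetPset => x [Ox nF]; split => // FN.
  apply: nF => y xy; apply: FN; apply: lt_le_trans xy _.
  by rewrite lef_pV2 ?posrE// ler_nat.
- rewrite (_ : \bigcap_i _ = set0) ?measure0 ?lte_fin// -subset0 => x Fx.
  have [Ox _] := Fx 0%N I.
  have /dN[r r0 rO] : nbhs x O by exact: open_nbhs_nbhs.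
  near \oo => N.
  have [_] := Fx N I; apply => y xy; apply: rO => /=.
  apply: lt_trans xy _; near: N; exact: (near_infty_natSinv_lt (PosNum r0)).
- by exists (F N), O; split => //; exact: ltW.
Unshelve. all: by end_near. Qed.

(** All outer sets are united, but only finitely many of the inner ones, so that the union stays
    closed; continuity from above controls the remainder. *)
Lemma closed_open_approx_bigcup (A : (set X)^nat) :
  (forall k, closed_open_approx mu (A k)) ->
  closed_open_approx mu (\bigcup_k A k).
Proof.
move=> hA e e0.
have e2 : 0 < e / 2 by lra.
have ek k : 0 < e / 2 / (2 ^ k.+1)%:R by rewrite divr_gt0// ltr0n expn_gt0.
have /choice[FO hFO] : forall k, exists FO : set X * set X,
    [/\ closed FO.1, open FO.2, FO.1 `<=` A k, A k `<=` FO.2 &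
     (mu (FO.2 `\` FO.1) <= (e / 2 / (2 ^ k.+1)%:R)%:E)%E].
  by move=> k; have [F [V ?]] := hA k _ (ek k); exists (F, V).
pose O := \bigcup_k (FO k).2.
pose F N := \big[setU/set0]_(k < N) (FO k).1.
have oO : open O by apply: bigcup_open => k _; case: (hFO k).
have cF N : closed (F N).
  by rewrite /F; apply: closed_bigsetU => k _; case: (hFO k).
have mFO k : measurable ((FO k).2 `\` (FO k).1 : set (borel X)).
  have [? ? _ _ _] := hFO k; apply: (@measurableD _ (borel X)).
    exact: measurable_open.
  exact: measurable_closed.
have mOF N : measurable (O `\` F N : set (borel X)).
  apply: (@measurableD _ (borel X)); first exact: measurable_open.
  exact: measurable_closed.
have [||//|N hN] := @nonincreasing_measure_lt _ _ _ mu (fun N => O `\` F N) e.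
- exact: mOF.
- apply/nonincreasing_seqP => N; apply/subsetPset; apply: setDS.
  by rewrite /F big_ord_recr; exact: subsetUl.
(* The errors of the single sets add up to at most [e / 2], which leaves room for the strict
   inequality. *)
- apply: (@le_lt_trans _ _ (e / 2)%:E); last by rewrite lte_fin; lra.
  apply: (@le_trans _ _ (\sum_(k <oo) mu ((FO k).2 `\` (FO k).1))%E).
    apply: measure_sigma_subadditive => //; first exact: bigcapT_measurable.
    move=> x Ix; have [[k _ Okx] _] := Ix 0%N I; exists k => //; split => //.
    move=> Fkx; have [_] := Ix k.+1 I; apply.
    by rewrite /F big_ord_recr; right.
  apply: le_trans (epsilon_trick0 xpredT (ltW e2)).
  by apply: lee_nneseries => // k _; case: (hFO k).
- exists (F N), O; split => //; last exact: ltW.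
    rewrite /F -(bigcup_mkord N (fun k => (FO k).1)) => x [k _ Fkx]; exists k => //.
    by have [_ _ + _ _] := hFO k; exact.
  move=> x [k _ Akx]; exists k => //.
  by have [_ _ _ + _] := hFO k; exact.
Qed.

Lemma closed_open_approx_borel (A : set X) :
  measurable (A : set (borel X)) -> closed_open_approx mu A.
Proof.
suff : <<s @open X >> `<=` closed_open_approx mu by exact.
apply: smallest_sub; last by move=> O; exact: closed_open_approx_open.
split.
- move=> e e0; exists set0, set0; split=> //; [exact: closed0|exact: open0|].
  by rewrite setD0 measure0 lee_fin ltW.
- by move=> B hB; rewrite setTD; exact: closed_open_approxC.
- exact: closed_open_approx_bigcup.
Qed.

End regularity.

Section separable.
Hypothesis sepX : separable_space X.

Lemma separable_dense_seq :
  exists q : nat -> X, forall x e, 0 < e -> exists k, d (q k) x < e.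
Proof.
have [D cD dD] := sepX.
have DO x e : 0 < e -> exists2 y, D y & d x y < e.
  move=> e0; have [|y [xy Dy]] := dD [set y | d x y < e] _ (open_metric_ball x e).
    by exists x => /=; have [[-> _ _ _] _] := dX.
  by exists y.
(* [D] meets the ball of radius 1 around [point], so it is not empty and a sequence enumerates
   it. *)
have /pfcard_geP[D0|[q]] := cD.
  by have [y] := DO point 1 ltr01; rewrite D0.
exists q => x e e0; have [y Dy xy] := DO x e e0.
have [k _ qk] := @surj _ _ _ _ q y Dy; exists k.
by rewrite qk; have [[_ _ -> _] _] := dX.
Qed.

End separable.

Section completeness.
Hypothesis cX : complete_metric d.

Lemma ultra_bigsetU (T : Type) (F : set_system T) (A : nat -> set T) N :
  UltraFilter F -> F (\big[setU/set0]_(k < N) A k) -> exists k, F (A k).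
Proof.
move=> FU; elim: N => [|N IH]; first by rewrite big_ord0 => /filter_ex[].
rewrite big_ord_recr/= => FUA.
have [FA|FA] := in_ultra_setVsetC (A N) FU; first by exists N.
by apply: IH; apply: filterS (filterI FUA FA) => x [[]].
Qed.

(* Totally bounded closed sets are compact in a complete metric space. *)
Lemma compact_bigcap_bigsetU (q : nat -> X) (N : nat -> nat) :
  compact (\bigcap_m \big[setU/set0]_(k < N m)
    [set x | d (q k) x <= m.+1%:R^-1]).
Proof.
have [[d0 _ dC dT] dN] := dX.
set K := \bigcap_m _.
have clK : closed K.
  apply: closed_bigI => m _; apply: closed_bigsetU => k _.
  exact: closed_metric_ball.
rewrite compact_ultra => F FU FK.
have /choice[k Fk] : forall m, exists k, F [set x | d (q k) x <= m.+1%:R^-1].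
  move=> m; apply: (@ultra_bigsetU _ _ _ (N m)) => //.
  by apply: filterS FK => x; exact.
(* The ultrafilter selects one ball of each radius. Points of the finite intersections of these
   balls form a Cauchy sequence, and its limit is the limit of [F]. *)
pose B m := \big[setI/setT]_(i < m.+1) [set x | d (q (k i)) x <= i.+1%:R^-1].
have /choice[u uB] : forall m, exists x, B m x.
  move=> m; apply: (@filter_ex _ F); rewrite /B.
  by apply: (big_ind F) => [|A A'|i _]; [exact: filterT|exact: filterI|exact: Fk].
have uk m j : (m <= j)%N -> d (q (k m)) (u j) <= m.+1%:R^-1.
  move=> mj; have := uB j; rewrite /B.
  rewrite -(bigcap_mkord j.+1 (fun i => [set x | d (q (k i)) x <= i.+1%:R^-1])).
  apply.
  by rewrite /= ltnS.
have near_inv (e : R) : 0 < e -> exists m : nat, m.+1%:R^-1 < e.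
  move=> e0; near \oo => m; exists m; near: m.
  exact: (near_infty_natSinv_lt (PosNum e0)).
have u_cauchy (e : R) : 0 < e ->
    exists M, forall i j, (M <= i)%N -> (M <= j)%N -> d (u i) (u j) < e.
  move=> e0; have [m me] := near_inv (e / 2) ltac:(lra); exists m => i j mi mj.
  have := dT (u i) (q (k m)) (u j); rewrite (dC (u i) (q (k m))).
  have := uk _ _ mi; have := uk _ _ mj; move: me.
  move: (_^-1) => r; lra.
have [l ul] := cX u_cauchy.
have Fl : F --> l.
  move=> A /metrizes_nbhs[e e0 eA].
  have [m me] := near_inv (e / 3) ltac:(lra).
  have [M hM] := ul (e / 3) ltac:(lra).
  apply: filterS (Fk m) => x /= qx; apply: eA => /=.
  have := uk m (maxn m M) (leq_maxl _ _).
  have := hM (maxn m M) (leq_maxr _ _).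
  have := dT l (u (maxn m M)) x; have := dT (u (maxn m M)) (q (k m)) x.
  rewrite (dC (u _) l) (dC (u _) (q _)); move: me qx.
  move: (_^-1) => r; lra.
exists l; split => //; apply: clK => A /Fl FA.
by have [x] := filter_ex (@filterI _ F _ _ _ FK FA); exists x.
Unshelve. all: by end_near. Qed.

(** Ulam's argument: for every m, finitely many balls of radius 1/(m+1) carry all but [e / 2 ^ m.+1]
    of the mass, and the intersection over m of these finite unions is compact. *)
Lemma tight_probability (mu : probability (borel X) R) (e : R) :
  separable_space X -> 0 < e ->
  exists K : set X, [/\ compact K, closed K & (mu (~` K) <= e%:E)%E].
Proof.
move=> sepX e0; have [q qX] := separable_dense_seq sepX.
pose C m N := \big[setU/set0]_(k < N) [set x | d (q k) x <= m.+1%:R^-1].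
have cC m N : closed (C m N).
  by apply: closed_bigsetU => k _; exact: closed_metric_ball.
have mC m N : measurable (~` C m N : set (borel X)).
  by apply: measurable_open; exact: closed_openC.
have em m : 0 < e / (2 ^ m.+1)%:R by rewrite divr_gt0// ltr0n expn_gt0.
have /choice[N hN] : forall m, exists N,
    (mu (~` C m N) < (e / (2 ^ m.+1)%:R)%:E)%E.
  move=> m; apply: nonincreasing_measure_lt => //.
  - apply/nonincreasing_seqP => N; apply/subsetPset; apply: subsetC.
    by rewrite /C big_ord_recr; exact: subsetUl.
  - rewrite (_ : \bigcap_i _ = set0) ?measure0 ?lte_fin// -subset0 => x Cx.
    have [k qk] := qX x m.+1%:R^-1 ltac:(by rewrite invr_gt0).
    by apply: (Cx k.+1 I); rewrite /C big_ord_recr; right; exact: ltW.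
exists (\bigcap_m C m (N m)); split.
- exact: compact_bigcap_bigsetU.
- by apply: closed_bigI => m _; exact: cC.
- rewrite setC_bigcap; apply: le_trans (epsilon_trick0 xpredT (ltW e0)).
  apply: (@le_trans _ _ (\sum_(m <oo) mu (~` C m (N m)))%E).
    apply: measure_sigma_subadditive => //.
    by apply: (@bigcupT_measurable _ (borel X)).
  by apply: lee_nneseries => // m _; exact: ltW.
Qed.

End completeness.
End metrizable.

(** * Borel sets of finite powers *)

Lemma sigma_open_preimage (Y Z : topologicalType) (f : Y -> Z) (A : set Z) :
  continuous f -> <<s @open Z >> A -> <<s @open Y >> (f @^-1` A).
Proof.
move=> cf; suff : <<s @open Z >> `<=` [set B | <<s @open Y >> (f @^-1` B)].
  exact.
have [sY0 sYC sYU] := smallest_sigma_algebra [set: Y] (@open Y).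
apply: smallest_sub; last first.
  by move=> B oB; apply: sub_sigma_algebra; apply: open_comp => // x _; exact: cf.
split=> [|B|B]; first by rewrite /= preimage_set0.
  by move=> /sYC; rewrite !setTD preimage_setC.
by move=> mB; rewrite /= preimage_bigcup; exact: sYU.
Qed.

Section product.
Context {X : ptopologicalType} {n : nat}.
Implicit Types A V : 'I_n -> set X.

Definition box A : set (npow X n) := [set x | forall i, A i (x i)].

Lemma coord_continuous i : continuous (fun x : npow X n => x i).
Proof. exact: (@proj_continuous _ (fun=> X) i). Qed.

Lemma measurable_coord i :
  measurable_fun [set: borel (npow X n)]
    ((fun x => x i) : borel (npow X n) -> borel X).
Proof.
move=> _ A mA; rewrite setTI.
exact: (@sigma_open_preimage (npow X n) X _ A (@coord_continuous i) mA).
Qed.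

Lemma boxE A : box A = \bigcap_(i in [set: 'I_n]) ((fun x => x i) @^-1` A i).
Proof. by apply/seteqP; split=> [x Ax i _|x Ax i]; [exact: Ax|exact: (Ax i)]. Qed.

Lemma measurable_box A :
  (forall i, measurable (A i : set (borel X))) ->
  measurable (box A : set (borel (npow X n))).
Proof.
move=> mA; rewrite boxE; apply: (@fin_bigcap_measurable _ (borel (npow X n))).
  exact: finite_finset.
by move=> i _; rewrite -[X in measurable X]setTI; exact: measurable_coord.
Qed.

Lemma boxI A V : box A `&` box V = box (fun i => A i `&` V i).
Proof.
by apply/seteqP; split=> [x [Ax Vx] i|x AVx]; split=> // i; case: (AVx i).
Qed.

(** The boxes with neighbourhoods as sides generate a filter that converges to [x] in each
    coordinate, hence in the product topology. *)
Lemma nbhs_box (x : npow X n) (O : set (npow X n)) : nbhs x O ->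
  exists2 V, forall i, nbhs (x i) (V i) & box V `<=` O.
Proof.
pose F := filter_from [set V | forall i, nbhs (x i) (V i)] box.
have FF : Filter F.
  apply: filter_from_filter; first by exists (fun=> setT) => i; exact: filterT.
  move=> A V hA hV; exists (fun i => A i `&` V i); last by rewrite boxI.
  by move=> i; apply: filterI; [exact: hA|exact: hV].
suff : F --> x by move=> Fx /Fx.
apply/cvg_sup => i; apply/cvg_image.
  by rewrite eqEsubset; split=> // y _; exists (fun=> y).
move=> A xA; exists ((fun f : 'I_n -> X => f i) @^-1` A); last first.
  by rewrite image_preimage// eqEsubset; split=> // y _; exists (fun=> y).
exists (fun j => if j == i then A else setT); last by move=> y /(_ i); rewrite eqxx.
by move=> j /=; case: eqP => [->//|_]; exact: filterT.
Qed.

Lemma diagonal_continuous : continuous ((fun x _ => x) : X -> npow X n).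
Proof.
move=> x A /nbhs_box[V xV VA].
apply: (@filterS _ (nbhs x) _ _ _ _ (filter_forall (nbhs_filter x) xV)) => y yV.
exact: VA.
Qed.

Lemma perm_coord_continuous (s : {perm 'I_n}) :
  continuous (perm_coord s : npow X n -> npow X n).
Proof.
move=> x A /nbhs_box[V xV VA].
have : nbhs x [set y | forall i, V i (y (s i))].
  apply: (@filter_forall _ 'I_n (fun i y => V i (y (s i))) (nbhs x)) => i.
  exact: (@coord_continuous (s i) x _ (xV i)).
by move=> xsV; apply: (@filterS _ (nbhs x) _ _ _ _ xsV) => y yV; exact: VA.
Qed.

(** * Second countability of the product and its measurable rectangles *)

Section second_countable.
Context {R : realType} (d : X -> X -> R).
Hypotheses (dX : metrizes d) (sepX : separable_space X).

(** Boxes of balls with centres in a dense sequence and radii 1/(m+1) form a countable base; each is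
    coded by a finite function, and this by a number. *)
Lemma open_bigcup_box (O : set (npow X n)) : open O ->
  exists (D : set nat) (V : nat -> 'I_n -> set X),
    (forall k i, open (V k i)) /\ O = \bigcup_(k in D) box (V k).
Proof.
move=> oO; have [q qX] := separable_dense_seq dX sepX.
pose W (f : {ffun 'I_n -> nat * nat}) (i : 'I_n) :=
  [set y | d (q (f i).1) y < (f i).2.+1%:R^-1].
(* Numbers that code nothing get empty sides; these are open, and the index set keeps only boxes
   inside [O]. *)
pose V k := if unpickle k is Some f then W f else fun=> set0.
exists [set k | box (V k) `<=` O], V; split.
  move=> k i; rewrite /V.
  by case: unpickle => [f|]; [exact: open_metric_ball|exact: open0].
apply/seteqP; split=> [x Ox|x [k kO]]; last exact: kO.
have [U xU UO] : exists2 U, forall i, nbhs (x i) (U i) & box U `<=` O.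
  by apply: nbhs_box; exact: open_nbhs_nbhs.
have /choice[f hf] : forall i, exists km : nat * nat,
    d (q km.1) (x i) < km.2.+1%:R^-1 /\
    [set y | d (q km.1) y < km.2.+1%:R^-1] `<=` U i.
  move=> i; have [e e0 eU] := metrizes_nbhs dX (xU i).
  have e2 : 0 < e / 2 by lra.
  near \oo => m.
  have [k qk] := qX (x i) m.+1%:R^-1 ltac:(by rewrite invr_gt0).
  have me : m.+1%:R^-1 < e / 2.
    by near: m; exact: (near_infty_natSinv_lt (PosNum e2)).
  exists (k, m); split => // y /= qy; apply: eU => /=.
  have [[_ _ dC dT] _] := dX; have := dT (x i) (q k) y; rewrite (dC (x i) (q k)).
  by move: (_^-1) me qk qy => r; lra.
exists (pickle (finfun f)).
  rewrite /= /V pickleK => y yW; apply: UO => i.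
  by apply: (hf i).2; have := yW i; rewrite /W ffunE.
by rewrite /V pickleK => i; rewrite /W ffunE; exact: (hf i).1.
Unshelve. all: by end_near. Qed.

Definition boxes : set (set (npow X n)) :=
  [set box A | A in [set A | forall i, measurable (A i : set (borel X))]].

Lemma boxesI : setI_closed boxes.
Proof.
move=> _ _ [A mA <-] [B mB <-]; exists (fun i => A i `&` B i); last by rewrite boxI.
by move=> i; apply: (@measurableI _ (borel X)).
Qed.

Lemma boxesT : boxes setT.
Proof.
exists (fun=> setT); first by move=> i; exact: (@measurableT _ (borel X)).
by apply/seteqP; split.
Qed.

(** Stated for any [C] containing the boxes because it is used for the boxes themselves and for the
    sets regular for the limit content. *)
Lemma sub_sigma_boxes_open (C : set (set (npow X n))) :
  boxes `<=` C -> @open (npow X n) `<=` <<s C >>.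
Proof.
move=> BC O /open_bigcup_box[D [V [oV ->]]].
apply: (@bigcup_measurable _ (g_sigma_algebraType C)) => k _.
apply: sub_sigma_algebra; apply: BC; exists (V k) => // i.
by apply: measurable_open; exact: oV.
Qed.

(** This allows measurability and equality of measures to be tested on boxes, also for [diag_map U]
    with [U] merely Borel. *)
Lemma borel_npowE :
  @measurable _ (borel (npow X n)) = <<s boxes >> :> set (set (npow X n)).
Proof.
apply/seteqP; split.
  apply: smallest_sub; first exact: smallest_sigma_algebra.
  exact: sub_sigma_boxes_open.
apply: smallest_sub; first exact: smallest_sigma_algebra.
by move=> _ [A mA <-]; exact: measurable_box.
Qed.

Lemma measurable_diag_map (U : X -> X) :
  measurable_fun [set: borel X] (U : borel X -> borel X) ->
  measurable_fun [set: borel (npow X n)]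
    (diag_map U : borel (npow X n) -> borel (npow X n)).
Proof.
move=> mU; apply: (@measurability _ _ (borel (npow X n)) (borel (npow X n))
  setT _ boxes borel_npowE) => _ [_ [A mA <-] <-].
rewrite setTI; apply: (@measurable_box (fun i => U @^-1` A i)) => i.
by rewrite -[X in measurable X]setTI; exact: mU.
Qed.

Lemma borel_npow_measure_unique (m1 m2 : probability (borel (npow X n)) R) :
  (forall B, boxes B -> m1 B = m2 B) -> Defs.eq_measure m1 m2.
Proof.
move=> m12 A mA; apply: (@g_sigma_algebra_measure_unique _ _ (borel (npow X n))
  boxes _ (fun=> setT)) => //.
- by move=> _ [B mB <-]; exact: measurable_box.
- by move=> _; exact: boxesT.
- by apply/seteqP; split=> // x _; exists 0%N.
- exact: boxesI.
- by move=> _; rewrite [X in (X < _)%E]probability_setT ltry.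
- by rewrite -borel_npowE.
Qed.

End second_countable.
End product.

(** * Countable additivity of tight contents *)

Section tight_content.
Context {R : realType} {Y : ptopologicalType}.

(** Additivity is asked on Borel sets only, but nonnegativity on all sets, as in the definition of a
    content. *)
Record tight_content := TightContent {
  tc_fun :> set Y -> R;
  tc_ge0 : forall A, 0 <= tc_fun A;
  tc_add : forall A B : set Y, measurable (A : set (borel Y)) ->
    measurable (B : set (borel Y)) -> A `&` B = set0 ->
    tc_fun (A `|` B) = tc_fun A + tc_fun B;
  tc_tight : forall e, 0 < e ->
    exists K, [/\ compact K, closed K & tc_fun (~` K) <= e] }.

Variable L : tight_content.
Implicit Types A B : set (borel Y).

Lemma tc_set0 : L set0 = 0.
Proof.
have := @tc_add L set0 set0 (@measurable0 _ (borel Y)) (@measurable0 _ (borel Y))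
  (setI0 _).
by rewrite setU0 => h; lra.
Qed.

Lemma tc_setD A B : measurable A -> measurable B -> B `<=` A ->
  L A = L B + L (A `\` B).
Proof.
move=> mA mB BA; rewrite -tc_add//; [|exact: measurableD|].
  by rewrite setDUK.
by rewrite setDIK.
Qed.

Lemma le_tc A B : measurable A -> measurable B -> A `<=` B -> L A <= L B.
Proof.
by move=> mA mB AB; rewrite (tc_setD mB mA AB) lerDl; exact: tc_ge0.
Qed.

Lemma tc_setU A B : measurable A -> measurable B -> L (A `|` B) <= L A + L B.
Proof.
move=> mA mB; rewrite (_ : A `|` B = A `|` (B `\` A)); last first.
  by rewrite setUDr setDv setD0.
rewrite tc_add//; [|exact: measurableD|by rewrite setDIK].
by rewrite lerD2l; apply: le_tc => //; exact: measurableD.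
Qed.

Lemma tc_bigsetU (A : nat -> set (borel Y)) N :
  (forall k, measurable (A k)) ->
  L (\big[setU/set0]_(k < N) A k) <= \sum_(k < N) L (A k).
Proof.
move=> mA; elim: N => [|N IH]; first by rewrite !big_ord0 tc_set0.
rewrite !big_ord_recr/=; apply: le_trans (tc_setU _ _) _ => //.
  exact: bigsetU_measurable.
by rewrite lerD2r.
Qed.

(** These sets are only shown to form an algebra: the argument for countable unions uses continuity
    from above, and [L] is only finitely additive. *)
Definition regular_sets : set (set Y) :=
  [set A | measurable (A : set (borel Y)) /\
           closed_open_approx (fun B => (L B)%:E) A].

Lemma regular_set0 : regular_sets set0.
Proof.
split; first exact: (@measurable0 _ (borel Y)).
move=> e e0; exists set0, set0; split=> //; [exact: closed0|exact: open0|].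
by rewrite setD0 tc_set0 lee_fin ltW.
Qed.

Lemma regular_setC : setC_closed regular_sets.
Proof.
move=> A [mA hA]; split; first exact: (@measurableC _ (borel Y)).
exact: closed_open_approxC.
Qed.

Lemma regular_setU : setU_closed regular_sets.
Proof.
move=> A B [mA hA] [mB hB]; split; first exact: (@measurableU _ (borel Y)).
move=> e e0; have e2 : 0 < e / 2 by lra.
have [F [V [cF oV FA AV LVF]]] := hA _ e2.
have [F' [V' [cF' oV' FB BV LVF']]] := hB _ e2.
have mVF : measurable (V `\` F : set (borel Y)).
  by apply: measurableD; [exact: measurable_open|exact: measurable_closed].
have mVF' : measurable (V' `\` F' : set (borel Y)).
  by apply: measurableD; [exact: measurable_open|exact: measurable_closed].
exists (F `|` F'), (V `|` V'); split.
- exact: closedU.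
- exact: openU.
- exact: setUSS.
- exact: setUSS.
- rewrite lee_fin; apply: (@le_trans _ _ (L ((V `\` F) `|` (V' `\` F')))).
    apply: le_tc; last by move=> x [[Vx|Vx] /not_orP[? ?]]; [left|right].
    + apply: measurableD.
        by apply: measurable_open; exact: openU.
      by apply: measurable_closed; exact: closedU.
    + exact: measurableU.
  apply: le_trans (tc_setU _ _) _ => //.
  by move: LVF LVF'; rewrite !lee_fin; lra.
Qed.

End tight_content.
Arguments tight_content R Y : clear implicits.

(* A copy of the carrier, on which the sets regular for [L] form the algebra of
   measurable sets. *)
Definition regular_type (R : realType) (Y : ptopologicalType)
  (L : tight_content R Y) : Type := Y.

Definition regular_display (R : realType) (Y : ptopologicalType)
  (L : tight_content R Y) : measure_display.
Proof. exact: default_measure_display. Qed.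

Section regular_algebra.
Context {R : realType} {Y : ptopologicalType} (L : tight_content R Y).

HB.instance Definition _ := Pointed.copy (regular_type L) Y.
HB.instance Definition _ := @isAlgebraOfSets.Build (regular_display L)
  (regular_type L) (regular_sets L) (regular_set0 L) (@regular_setU _ _ L)
  (@regular_setC _ _ L).

Definition regular_content (A : set (regular_type L)) : \bar R := (L A)%:E.

Let regular_content_ge0 A : (0 <= regular_content A)%E.
Proof. by rewrite lee_fin tc_ge0. Qed.

Let regular_content_semi_additive : measure_function.semi_additive regular_content.
Proof.
move=> F n mF tF _; rewrite /regular_content sumEFin; congr EFin.
elim: n => [|n IH]; first by rewrite !big_ord0 tc_set0.
rewrite !big_ord_recr/= tc_add ?IH//.
- by apply: (@bigsetU_measurable _ (borel Y)) => k _; case: (mF k).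
- by case: (mF n).
- rewrite big_distrl/= big1// => k _.
  by move/trivIsetP : tF; apply => //; rewrite neq_ltn ltn_ord.
Qed.

HB.instance Definition _ := isContent.Build (regular_display L) (regular_type L) R
  regular_content regular_content_ge0 regular_content_semi_additive.

(* Alexandroff: tightness reduces a countable cover by slightly larger open
   sets to a finite one. *)
Let regular_content_sigma_subadditive :
  measurable_subset_sigma_subadditive regular_content.
Proof.
move=> A F mF [mA hA] AF; apply/lee_addgt0Pr => e e0.
have e2 : 0 < e / 2 by lra.
have e4 : 0 < e / 4 by lra.
have ek k : 0 < e / 2 / (2 ^ k.+1)%:R by rewrite divr_gt0// ltr0n expn_gt0.
have [C [W [clC oW CA AW LWC]]] := hA _ e4.
have [K0 [cK0 clK0 LK0]] := tc_tight L e4.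
have mC : measurable (C : set (borel Y)) by exact: measurable_closed.
have mK0 : measurable (K0 : set (borel Y)) by exact: measurable_closed.
have mW : measurable (W : set (borel Y)) by exact: measurable_open.
(* [K] is a compact part of [A] that misses at most [e / 4 + e / 4] of it, one share for the
   regularity of [A] and one for tightness. The other [e / 2] is spread over the cover. *)
pose K := K0 `&` C.
have mK : measurable (K : set (borel Y)) by exact: measurableI.
have cK : compact K by exact: compact_closedI.
have /choice[V hV] : forall k, exists V : set Y, [/\ open V, F k `<=` V &
    L V <= L (F k) + e / 2 / (2 ^ k.+1)%:R].
  move=> k; have [mFk /(_ _ (ek k))[D [V [clD oV DF FV LVD]]]] := mF k.
  have mV : measurable (V : set (borel Y)) by exact: measurable_open.
  exists V; split => //; rewrite (tc_setD L mV mFk FV) lerD2l.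
  move: LVD; rewrite lee_fin; apply: le_trans; apply: le_tc; last exact: setDS.
    exact: measurableD.
  by apply: measurableD => //; exact: measurable_closed.
have mV k : measurable (V k : set (borel Y)).
  by apply: measurable_open; case: (hV k).
have [N KN] : exists N, K `<=` \big[setU/set0]_(k < N) V k.
  move: cK; rewrite compact_cover => /(_ nat setT V)[| |D _ KD].
  - by move=> k _; case: (hV k).
  - move=> x [_ Cx]; have [k _ Fkx] := AF _ (CA _ Cx); exists k => //.
    by have [_ + _] := hV k; exact.
  (* The finite subcover is enlarged to an initial segment, to be compared with a partial sum of the
     series. *)
  - exists (\max_(i <- finmap.enum_fset D) i).+1 => x /KD[k kD Vkx].
    rewrite -(bigcup_mkord _ V); exists k => //=; rewrite ltnS.
    exact: (@leq_bigmax_seq _ (finmap.enum_fset D) xpredT id).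
have LAK : L A <= L K + e / 2.
  rewrite (tc_setD L mA mK); last by move=> x [_ /CA].
  rewrite lerD2l; apply: (@le_trans _ _ (L ((W `\` C) `|` ~` K0))).
    apply: le_tc.
    - exact: measurableD.
    - by apply: measurableU; [exact: measurableD|exact: measurableC].
    - move=> x [Ax Kx]; have [K0x|?] := pselect (K0 x); last by right.
      by left; split; [exact: AW|move=> Cx; exact: Kx].
  apply: le_trans (tc_setU L _ _) _.
  - exact: measurableD.
  - exact: measurableC.
  - by move: LWC; rewrite lee_fin; lra.
have LKN : L K <= \sum_(k < N) L (F k) + e / 2.
  apply: (@le_trans _ _ (L (\big[setU/set0]_(k < N) V k))).
    by apply: le_tc => //; exact: bigsetU_measurable.
  apply: le_trans (tc_bigsetU L _ mV) _.
  apply: (@le_trans _ _ (\sum_(k < N) (L (F k) + e / 2 / (2 ^ k.+1)%:R))).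
    by apply: ler_sum => k _; case: (hV k).
  rewrite big_split/= lerD2l -lee_fin.
  apply: le_trans (epsilon_trick0 xpredT (ltW e2)).
  rewrite -sumEFin -(big_mkord xpredT (fun k => (e / 2 / (2 ^ k.+1)%:R)%:E)).
  by apply: nneseries_lim_ge => k _ _; rewrite lee_fin ltW.
apply: (@le_trans _ _ ((\sum_(k < N) L (F k))%:E + e%:E)%E).
  by rewrite -EFinD lee_fin; lra.
rewrite leeD2r// -sumEFin -(big_mkord xpredT (fun k => (L (F k))%:E)).
by apply: nneseries_lim_ge => k _ _; rewrite lee_fin tc_ge0.
Qed.

HB.instance Definition _ := Content_SigmaSubAdditive_isMeasure.Build
  (regular_display L) R (regular_type L) regular_content
  regular_content_sigma_subadditive.

(** Caratheodory's extension theorem, applied to the countably subadditive content on the algebra of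
    regular sets. *)
Lemma regular_content_extension :
  exists m : {measure set (g_sigma_algebraType (regular_sets L)) -> \bar R},
    forall A, regular_sets L A -> m A = (L A)%:E.
Proof.
pose m : {measure set (g_sigma_algebraType (@measurable _ (regular_type L)))
  -> \bar R} := measure_extension regular_content.
exists m => A rA.
by rewrite /m/= /measure_extension measurable_mu_extE.
Qed.

End regular_algebra.

(** * Lower semicontinuity of the cost *)

Section layer_cake.
Context (d : measure_display) (T : measurableType d) (R : realType).
Variable c : T -> \bar R.
Hypotheses (c_ge0 : forall x, (0 <= c x)%E) (c_meas : measurable_fun setT c).

(** The inequality is strict so that lower semicontinuity of the cost makes these sets open. *)
Definition superlevel (a : R) : set T := [set x | (a%:E < c x)%E].

(** Lower Riemann sum of the layer-cake formula: each of the levels r, 2r, ..., Jr that lies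
    strictly below [c x] contributes r. It lies between min(c, (J+1)r) - r and min(c, Jr). *)
Definition layers (r : R) (J : nat) (x : T) : \bar R :=
  (\sum_(j < J) r%:E * (\1_(superlevel (r *+ j.+1)) x)%:E)%E.

Lemma measurable_superlevel a : measurable (superlevel a).
Proof.
rewrite -[superlevel a]setTI.
exact: (emeasurable_fun_o_infty measurableT c_meas a%:E).
Qed.

Lemma layers_le (r : R) J x : 0 <= r ->
  (layers r J x <= Order.min (c x) (r *+ J)%:E)%E.
Proof.
move=> r0; elim: J => [|J IH].
  by rewrite /layers big_ord0 mulr0n le_min c_ge0 lexx.
rewrite /layers big_ord_recr/= -/(layers r J x) indicE.
have [cx|cx] := boolP (x \in superlevel (r *+ J.+1)).
  move: cx; rewrite inE /superlevel/= => cx; rewrite mule1 (min_r (ltW cx)).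
  move: IH; rewrite le_min => /andP[_ IH].
  by rewrite mulrSr EFinD; exact: leeD2r.
rewrite mule0 adde0; apply: le_trans IH _; rewrite le_min ge_min lexx/=.
by rewrite ge_min lee_fin ler_wpMn2l ?orbT.
Qed.

Lemma layers_ge (r : R) J x : 0 <= r ->
  (Order.min (c x) (r *+ J.+1)%:E <= r%:E + layers r J x)%E.
Proof.
move=> r0; elim: J => [|J IH].
  by rewrite /layers big_ord0 adde0 ge_min lexx orbT.
rewrite /layers big_ord_recr/= -/(layers r J x) indicE.
have [cx|cx] := boolP (x \in superlevel (r *+ J.+1)).
  move: cx; rewrite inE /superlevel/= => cx; rewrite mule1 addeA.
  move: IH; rewrite (min_r (ltW cx)) => IH.
  by rewrite ge_min mulrSr EFinD leeD2r ?orbT.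
rewrite mule0 adde0; apply: le_trans IH.
move: cx; rewrite notin_setE /superlevel/= => /negP; rewrite -leNgt => cx.
by rewrite (min_l cx) ge_min lexx.
Qed.

Lemma measurable_layers r J : measurable_fun setT (layers r J).
Proof.
apply: emeasurable_sum => j; apply: measurable_funeM; apply/measurable_EFinP.
by apply: measurable_indic; exact: measurable_superlevel.
Qed.

Lemma layers_ge0 (r : R) J x : 0 <= r -> (0 <= layers r J x)%E.
Proof.
by move=> r0; apply: sume_ge0 => j _; rewrite mule_ge0// lee_fin.
Qed.

Lemma integral_layers (m : {measure set T -> \bar R}) (r : R) J : 0 <= r ->
  (\int[m]_x layers r J x = \sum_(j < J) r%:E * m (superlevel (r *+ j.+1)))%E.
Proof.
move=> r0; rewrite ge0_integral_sum//.
- apply: eq_bigr => j _; have mS := measurable_superlevel (r *+ j.+1).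
  rewrite ge0_integralZl_EFin//.
  + by rewrite integral_indic// setIT.
  + exact/measurable_EFinP/measurable_indic.
- move=> j; apply: measurable_funeM; apply/measurable_EFinP.
  by apply: measurable_indic; exact: measurable_superlevel.
- by move=> j x _; rewrite mule_ge0// lee_fin.
Qed.

Lemma integral_truncation_cvg (m : {measure set T -> \bar R}) :
  (\int[m]_x Order.min (c x) N%:R%:E)%E @[N --> \oo] --> (\int[m]_x c x)%E.
Proof.
have cx x : Order.min (c x) N%:R%:E @[N --> \oo] --> c x.
  have := c_ge0 x; case: (c x) => [r _||//].
    apply: cvg_near_cst; near=> N; rewrite min_l// lee_fin.
    near: N; exact: nbhs_infty_ger.
  move=> _; under eq_fun do rewrite min_r ?leey//.
  exact/cvgenyP.
rewrite [X in _ --> X](_ : _ =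
    \int[m]_x limn (fun N => Order.min (c x) N%:R%:E))%E; last first.
  by apply: eq_integral => x _; apply/esym/cvg_lim => //; exact: cx.
apply: cvg_monotone_convergence => //.
- by move=> N; exact: measurable_mine.
- by move=> N x _; rewrite le_min c_ge0 lee_fin ler0n.
- move=> x _ N M NM; rewrite le_min ge_min lexx/=.
  by rewrite ge_min lee_fin ler_nat NM orbT.
Unshelve. all: by end_near. Qed.

(** Up to [e / 2], the integral of a truncation of [c] is bounded by a finite layer sum. Being
    finitely many, its superlevel sets can be compared with those of a single [p] whose cost is at
    most [t]. *)
Lemma integral_le_of_superlevels (m : probability T R)
    (F : set_system (probability T R)) (t : \bar R) :
  ProperFilter F ->
  (forall a e : R, 0 < e -> F [set p : probability T R |
    (m (superlevel a) <= p (superlevel a) + e%:E)%E]) ->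
  F [set p : probability T R | (\int[p]_x c x <= t)%E] -> (\int[m]_x c x <= t)%E.
Proof.
move=> FF mF tF; have cm := @integral_truncation_cvg m.
rewrite -(cvg_lim _ cm)//; apply: lime_le.
  by apply/cvg_ex; eexists; exact: cm.
apply: nearW => N; apply/lee_addgt0Pr => e e0.
have r0 : 0 < e / 2 by rewrite divr_gt0.
(* With steps of length [e / 2], [J.+1] steps reach the truncation level [N]. *)
pose J := Num.truncn (N%:R / (e / 2)).
have NJ : N%:R <= e / 2 *+ J.+1.
  have := truncnS_gt (N%:R / (e / 2)).
  by rewrite ltr_pdivrMr// -/J mulr_natl => /ltW.
(* Each of the [J] levels may err by 1/(J+1); weighted by the step length, these errors add up to at
   most [e / 2], also when [J] is 0. *)
have J0 : 0 < (J.+1%:R : R)^-1 by rewrite invr_gt0.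
have Fm : F [set p : probability T R | forall j : 'I_J,
    (m (superlevel (e / 2 *+ j.+1)) <=
     p (superlevel (e / 2 *+ j.+1)) + J.+1%:R^-1%:E)%E].
  by apply: filter_forall => j; exact: mF.
have [p [/= pt mp]] := filter_ex (filterI tF Fm).
apply: (@le_trans _ _ (\int[m]_x ((e / 2)%:E + layers (e / 2) J x))%E).
  apply: ge0_le_integral => //.
  - by move=> x _; rewrite le_min c_ge0 lee_fin ler0n.
  - exact: measurable_mine.
  - by apply: emeasurable_funD => //; exact: measurable_layers.
  - move=> x _; apply: le_trans (layers_ge _ _ (ltW r0)).
    by rewrite le_min !ge_min lexx/= lee_fin NJ orbT.
rewrite ge0_integralD//; last 3 first.
- by move=> x _; rewrite lee_fin ltW.
- by move=> x _; exact/layers_ge0/ltW.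
- exact: measurable_layers.
rewrite integral_cst// [X in (_ * X + _)%E]probability_setT mule1.
rewrite integral_layers ?(ltW r0)//.
apply: (@le_trans _ _ ((e / 2)%:E + (\int[p]_x layers (e / 2) J x + (e / 2)%:E))%E).
  rewrite leeD2l// integral_layers ?(ltW r0)//.
  apply: (@le_trans _ _ (\sum_(j < J) ((e / 2)%:E * p (superlevel (e / 2 *+ j.+1))
      + (e / 2 / J.+1%:R)%:E))%E).
    apply: lee_sum => j _; rewrite (EFinM (e / 2)) -muleDr//; last first.
      by rewrite ge0_adde_def// inE// lee_fin ltW.
    by rewrite lee_pmul2l//; exact: mp.
  rewrite big_split/= leeD2l// sumEFin lee_fin sumr_const card_ord.
  rewrite -(mulr_natr (e / 2 / J.+1%:R) J) -(mulrA (e / 2)) ler_piMr ?(ltW r0)//.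
  by rewrite mulrC ler_pdivrMr// mul1r ler_nat leqnSn.
have pl : (\int[p]_x layers (e / 2) J x <= t)%E.
  apply: le_trans pt; apply: ge0_le_integral => //.
  - by move=> x _; exact/layers_ge0/ltW.
  - exact: measurable_layers.
  - by move=> x _; apply: le_trans (layers_le _ _ (ltW r0)) _; rewrite ge_min lexx.
apply: (@le_trans _ _ ((e / 2)%:E + (t + (e / 2)%:E))%E).
  by rewrite leeD2l// leeD2r.
by rewrite addeCA -EFinD -splitr.
Qed.

End layer_cake.

(** * Cesaro averages *)

Section probability_of_measure.
Context (d : measure_display) (T : measurableType d) (R : realType).
Variable m : {measure set T -> \bar R}.
Hypothesis m1 : m setT = 1%E.

Definition normalized (_ : m setT = 1%E) : set T -> \bar R := m.

HB.instance Definition _ := Measure.copy (normalized m1) m.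
HB.instance Definition _ :=
  Measure_isProbability.Build _ _ _ (normalized m1) m1.

Definition probability_of_measure : probability T R := normalized m1.

End probability_of_measure.

Section averages.
Context (d : measure_display) (T : measurableType d) (R : realType).
Implicit Types (p q : probability T R) (f g : T -> T) (A : set T).

Definition quasi_invariant (e : R) p f := forall A, measurable A ->
  `|fine (p (f @^-1` A)) - fine (p A)| <= e.

Lemma measurable_iter f k : measurable_fun setT f -> measurable_fun setT (iter k f).
Proof.
move=> mf; elim: k => [|k IH]; first exact: measurable_id.
by apply: (measurableT_comp mf IH).
Qed.

Lemma measurable_preimage f A :
  measurable_fun setT f -> measurable A -> measurable (f @^-1` A).
Proof. by move=> mf mA; rewrite -[X in measurable X]setTI; exact: mf. Qed.

Lemma cesaro_probability f p (N : nat) : measurable_fun setT f ->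
  exists q : probability T R,
    (forall A, q A = (N.+1%:R^-1)%:E * \sum_(k < N.+1) p (iter k f @^-1` A))%E /\
    forall c : T -> \bar R, (forall x, 0 <= c x)%E -> measurable_fun setT c ->
      (\int[q]_x c x =
        (N.+1%:R^-1)%:E * \sum_(k < N.+1) \int[p]_x c (iter k f x))%E.
Proof.
move=> mf; have mfk k : measurable_fun setT (iter k f) by exact: measurable_iter.
pose fk k : {mfun T >-> T} := mfun_Sub (mem_set (mfk k)).
have N0 : (0 <= N.+1%:R^-1 :> R) by rewrite invr_ge0.
pose m : {measure set T -> \bar R} :=
  mscale (NngNum N0) (msum (fun k => distribution p (fk k)) N.+1).
have mE A : m A = ((N.+1%:R^-1)%:E * \sum_(k < N.+1) p (iter k f @^-1` A))%E.
  by [].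
have m1 : m setT = 1%E.
  rewrite mE (eq_bigr (fun=> 1%E)) => [|k _]; last first.
    by rewrite preimage_setT probability_setT.
  by rewrite sumEFin sumr_const card_ord -EFinM mulVf.
pose q : probability T R := probability_of_measure m1.
exists q; split=> [A|c c0 mc]; first exact: mE.
rewrite (@eq_measure_integral _ _ _ _ m)//.
rewrite ge0_integral_mscale// ge0_integral_measure_sum//; congr (_ * _)%E.
by apply: eq_bigr => k _; rewrite ge0_integral_distribution.
Qed.

(** The constant may be infinite, since the cost of a coupling may be. *)
Lemma average_cst (N : nat) (a : \bar R) (u : nat -> \bar R) :
  (forall k, u k = a) -> ((N.+1%:R^-1)%:E * \sum_(k < N.+1) u k = a)%E.
Proof.
move=> ua; rewrite (eq_bigr (fun=> a)) => [|k _]; last exact: ua.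
have -> M : (\sum_(k < M) a = M%:R%:E * a)%E.
  elim: M => [|M IH]; first by rewrite big_ord0 mul0e.
  by rewrite big_ord_recr/= IH -natr1 EFinD ge0_muleDl ?lee_fin// mul1e.
by rewrite muleA -EFinM mulVf// mul1e.
Qed.

(** Pulling back by [f] shifts the sum by one index, so the difference telescopes to its two end
    terms, both in [0,1]. A map [g] commuting with [f] passes through the iterates, so its bound,
    uniform over measurable sets, survives averaging. The last two items average a constant. *)
Lemma cesaro_average f p (N : nat) : measurable_fun setT f ->
  exists q : probability T R,
    [/\ quasi_invariant N.+1%:R^-1 q f,
        forall e g, measurable_fun setT g -> g \o f = f \o g ->
          quasi_invariant e p g -> quasi_invariant e q g,
        forall A (a : \bar R), (forall k, p (iter k f @^-1` A) = a) -> q A = a &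
        forall c : T -> \bar R, (forall x, 0 <= c x)%E ->
          measurable_fun setT c -> c \o f = c ->
          (\int[q]_x c x = \int[p]_x c x)%E].
Proof.
move=> mf; have [q [qE qint]] := cesaro_probability p N mf; exists q.
have N0 : 0 <= (N.+1%:R : R)^-1 by rewrite invr_ge0.
have mk k A : measurable A -> measurable (iter k f @^-1` A).
  by move=> mA; apply: measurable_preimage => //; exact: measurable_iter.
have fineq A : measurable A ->
    fine (q A) = N.+1%:R^-1 * \sum_(k < N.+1) fine (p (iter k f @^-1` A)).
  move=> mA; rewrite qE (eq_bigr (fun k : 'I_N.+1 =>
    (fine (p (iter k f @^-1` A)))%:E)) => [|k _].
    by rewrite sumEFin -EFinM.
  by rewrite fineK// fin_num_measure//; exact: mk.
split.
- move=> A mA; rewrite !fineq//; last exact: measurable_preimage.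
  rewrite -mulrBr normrM ger0_norm// ler_piMr//.
  rewrite big_ord_recr big_ord_recl/=.
  rewrite (_ : \sum_(i < N) fine (p (iter i f @^-1` (f @^-1` A))) =
    \sum_(i < N) fine (p (iter (bump 0 i) f @^-1` A)))//.
  rewrite [X in _ - X]addrC opprD addrACA subrr add0r.
  have p01 B : measurable B -> 0 <= fine (p B) <= 1.
    move=> mB; rewrite fine_ge0//= -lee_fin fineK ?fin_num_measure//.
    exact: probability_le1.
  have /andP[a0 a1] := p01 _ (mk N _ (measurable_preimage mf mA)).
  have /andP[b0 b1] := p01 _ (mk 0%N _ mA).
  by rewrite ler_norml; apply/andP; split; lra.
- move=> e g mg gf pg A mA; rewrite !fineq//; last exact: measurable_preimage.
  rewrite -mulrBr normrM ger0_norm// -sumrB ler_pdivrMl//.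
  apply: le_trans (ler_norm_sum _ _ _) _.
  rewrite mulr_natl -[X in e *+ X]card_ord -sumr_const.
  apply: ler_sum => k _.
  rewrite (_ : iter k f @^-1` (g @^-1` A) = g @^-1` (iter k f @^-1` A)).
    by apply: pg; exact: mk.
  have gfk x : iter k f (g x) = g (iter k f x).
    elim: (k : nat) => [//|j IH]; rewrite !iterS IH.
    exact: (congr1 (@^~ (iter j f x)) (esym gf)).
  by apply/seteqP; split=> x /=; rewrite gfk.
- move=> A a pa; rewrite qE.
  exact: (@average_cst N a (fun k => p (iter k f @^-1` A))).
- move=> c c0 mc cf; rewrite qint//.
  apply: (@average_cst N _ (fun k => \int[p]_x c (iter k f x))%E) => k.
  apply: eq_integral => x _; elim: k => [//|k IH].
  by rewrite -[RHS]IH iterS -[in RHS]cf.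
Qed.

End averages.

(** * Ultralimits of couplings *)

(** By compactness the image ultrafilter has a cluster point in [0,1], and a cluster point of an
    ultrafilter is a limit. *)
Lemma ultra_cvg01 (R : realType) (T : Type) (U : set_system T) (f : T -> R) :
  UltraFilter U -> (forall x, 0 <= f x <= 1) -> exists l : R, f @ U --> l.
Proof.
move=> UU f01.
have U01 : (f @ U) `[0, 1]%classic.
  by apply: (@filterS _ U _ setT); [move=> x _ /=; rewrite in_itv/=|exact: filterT].
have [l [_ fl]] := @segment_compact R 0 1 _ (fmap_proper_filter f _) U01.
exists l => B lB; have [//|UC] := in_ultra_setVsetC (f @^-1` B) UU.
by have [y [? ?]] := fl (~` B) B UC lB.
Qed.

Section regular_extension.
Context {R : realType} {Y : ptopologicalType} (L : tight_content R Y).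
Variable m : {measure set (g_sigma_algebraType (regular_sets L)) -> \bar R}.
Hypothesis mL : forall A, regular_sets L A -> m A = (L A)%:E.

(** Finite unions are regular, so [m] and [L] agree on them; continuity from below of [m] and
    monotonicity of [L] conclude. [L] of the whole union may be larger, being only finitely
    additive. *)
Lemma regular_extension_bigcup_le (B : (set Y)^nat) :
  (forall k, regular_sets L (B k)) ->
  (m (\bigcup_k B k) <= (L (\bigcup_k B k))%:E)%E.
Proof.
move=> rB; have BE := bigcup_bigsetU_bigcup B.
have rBN N : regular_sets L (\big[setU/set0]_(k < N.+1) B k).
  by apply: (@bigsetU_measurable _ (regular_type L)) => k _; exact: rB.
have mBN N : <<s regular_sets L >> (\big[setU/set0]_(k < N.+1) B k).
  exact: sub_sigma_algebra.
have cB : m \o (fun N => \big[setU/set0]_(k < N.+1) B k) @ \oo -->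
    m (\bigcup_k B k).
  rewrite -BE; apply: nondecreasing_cvg_mu => //.
    exact: (@bigcupT_measurable _ (g_sigma_algebraType (regular_sets L))).
  by move=> N M NM; apply/subsetPset; exact: subset_bigsetU.
rewrite -(cvg_lim _ cB)//; apply: lime_le.
  by apply/cvg_ex; eexists; exact: cB.
apply: nearW => N; rewrite [X in (X <= _)%E](mL (rBN N)) lee_fin; apply: le_tc.
- exact: (rBN N).1.
- by apply: (@bigcupT_measurable _ (borel Y)) => M; exact: (rB M).1.
- by rewrite -BE => x Bx; exists N.
Qed.

End regular_extension.

Definition npow_ptopologicalType (X : ptopologicalType) (n : nat) :
    ptopologicalType :=
  HB.pack (npow X n) (Pointed.class ('I_n -> X)).

Section coupling_limit.
Context {R : realType} {X : ptopologicalType} {n : nat} (d : X -> X -> R).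
Hypotheses (dX : metrizes d) (cX : complete_metric d).
Hypothesis sepX : separable_space X.
Variable mu : probability (borel X) R.
Variable U : set_system (probability (borel (npow X n)) R).
Hypotheses (UU : UltraFilter U) (Umu : U (couplings mu)).

(** The absolute value ensures nonnegativity on all sets; on Borel sets the limit exists and is
    nonnegative, so nothing changes. *)
Definition ultralimit (A : set (npow X n)) : R :=
  `|lim ((fun p : probability (borel (npow X n)) R => fine (p A)) @ U)|.

Lemma ultralimit_cvg (A : set (borel (npow X n))) : measurable A ->
  (fun p : probability (borel (npow X n)) R => fine (p A)) @ U --> ultralimit A.
Proof.
move=> mA.
have p01 (p : probability (borel (npow X n)) R) : 0 <= fine (p A) <= 1.
  by rewrite fine_ge0//= -lee_fin fineK ?fin_num_measure// probability_le1.
have [l hl] := ultra_cvg01 UU p01.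
have l0 : 0 <= l.
  apply: (@closed_cvg _ _ U _ (fun p : probability (borel (npow X n)) R =>
    fine (p A)) [set x | 0 <= x]) hl.
  - exact: closed_ge.
  - by apply: nearW => p; case/andP: (p01 p).
by rewrite /ultralimit (cvg_lim _ hl)// ger0_norm.
Qed.

Lemma ultralimit_le (A : set (borel (npow X n))) (a : R) : measurable A ->
  U [set p : probability (borel (npow X n)) R | fine (p A) <= a] ->
  ultralimit A <= a.
Proof.
move=> mA Ua.
apply: (@closed_cvg _ _ U _ (fun p : probability (borel (npow X n)) R =>
  fine (p A)) [set x | x <= a]) (ultralimit_cvg mA) => //; exact: closed_le.
Qed.

Lemma ultralimit_eq (A : set (borel (npow X n))) (a : R) : measurable A ->
  U [set p : probability (borel (npow X n)) R | fine (p A) = a] ->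
  ultralimit A = a.
Proof.
move=> mA Ua; apply: (cvg_unique _ (ultralimit_cvg mA)) => //.
by apply: cvg_near_cst.
Qed.

Lemma ultralimit_setT : ultralimit setT = 1.
Proof.
apply: ultralimit_eq; first exact: measurableT.
by apply: (@filterS _ U _ setT) filterT => p _ /=; rewrite probability_setT.
Qed.

Lemma measurable_cylinder (A : set (borel X)) (i : 'I_n) : measurable A ->
  measurable ((fun x : npow X n => x i) @^-1` A : set (borel (npow X n))).
Proof. by move=> mA; rewrite -[X in measurable X]setTI; exact: measurable_coord. Qed.

Lemma ultralimit_cylinder (A : set (borel X)) (i : 'I_n) : measurable A ->
  ultralimit ((fun x => x i) @^-1` A) = fine (mu A).
Proof.
move=> mA; apply: ultralimit_eq; first exact: measurable_cylinder.
by apply: filterS Umu => p /(_ i A mA) /= <-.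
Qed.

Lemma ultralimit_setU (A B : set (borel (npow X n))) : measurable A ->
  measurable B -> A `&` B = set0 ->
  ultralimit (A `|` B) = ultralimit A + ultralimit B.
Proof.
move=> mA mB AB; apply: (cvg_unique _ (ultralimit_cvg (measurableU _ _ mA mB))) => //.
rewrite (_ : (fun p => _) = (fun p : probability (borel (npow X n)) R =>
    fine (p A) + fine (p B))).
  by apply: cvgD; exact: ultralimit_cvg.
by apply/funext => p; rewrite measureU// fineD// fin_num_measure.
Qed.

(** Tightness of [mu] is uniform over its couplings: the power of a compact [K] is compact by
    Tychonoff, and a coupling gives its complement at most the sum of the marginal masses outside
    [K]. *)
Lemma ultralimit_tight (e : R) : 0 < e -> exists K : set (npow X n),
  [/\ compact K, closed K & ultralimit (~` K) <= e].
Proof.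
(* Dividing by [n.+1] instead of [n] covers the case [n = 0]. *)
move=> e0; have en : 0 < e / n.+1%:R by rewrite divr_gt0.
have [K [cK clK muK]] := tight_probability dX cX mu sepX en.
have mK : measurable (K : set (borel X)) by exact: measurable_closed.
have mKC : measurable (~` K : set (borel X)) by exact: measurableC.
have mbox : measurable (~` box (fun=> K) : set (borel (npow X n))).
  by apply: (@measurableC _ (borel (npow X n))); exact: measurable_box.
exists (box (fun=> K)); split.
- exact: (@tychonoff 'I_n (fun=> X) (fun=> K)).
- rewrite boxE; apply: closed_bigI => i _; apply: closed_comp => // x _.
  exact: coord_continuous.
- apply: ultralimit_le => //; apply: filterS Umu => p pmu /=.
  rewrite -lee_fin fineK ?fin_num_measure//.
  (* The cylinders that cover the complement of the box, continued by empty sets to a sequence as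
     Boole's inequality requires. *)
  pose B k : set (borel (npow X n)) := if insub k is Some i
    then (fun x : npow X n => x (i : 'I_n)) @^-1` (~` K) else set0.
  have mB k : measurable (B k).
    by rewrite /B; case: insub => // i; exact: measurable_cylinder.
  apply: (@le_trans _ _ (p (\big[setU/set0]_(k < n) B k))).
    apply: le_measure; rewrite ?inE//; first exact: bigsetU_measurable.
    move=> x /existsNP[i Kxi]; rewrite -bigcup_mkord; exists i => /=.
      exact: ltn_ord.
    by rewrite /B valK.
  apply: (le_trans (Boole_inequality p (fun k _ => mB k))).
  apply: (@le_trans _ _ (\sum_(k < n) (e / n.+1%:R)%:E)%E).
    apply: lee_sum => k _; rewrite /B valK.
    suff : (marginal p k (~` K) <= (e / n.+1%:R)%:E)%E by [].
    by rewrite (pmu k _ mKC).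
  rewrite sumEFin lee_fin sumr_const card_ord -(mulr_natr (e / n.+1%:R) n) -mulrA.
  by rewrite ler_piMr ?(ltW e0)// mulrC ler_pdivrMr// mul1r ler_nat leqnSn.
Qed.

Definition ultralimit_content : tight_content R (npow_ptopologicalType X n) :=
  @TightContent R (npow_ptopologicalType X n) ultralimit
    (fun A => normr_ge0 _) ultralimit_setU ultralimit_tight.

(** On cylinders the limit content is given by [mu], so closed and open approximations for [mu] lift
    along the coordinate. *)
Lemma regular_cylinder (A : set (borel X)) (i : 'I_n) : measurable A ->
  regular_sets ultralimit_content ((fun x : npow X n => x i) @^-1` A).
Proof.
move=> mA; split; first exact: measurable_cylinder.
move=> e e0.
have [F [V [clF oV FA AV muVF]]] := closed_open_approx_borel dX mu mA e0.
have mF : measurable (F : set (borel X)) by exact: measurable_closed.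
have mV : measurable (V : set (borel X)) by exact: measurable_open.
exists ((fun x : npow X n => x i) @^-1` F), ((fun x : npow X n => x i) @^-1` V).
split.
- by apply: closed_comp => // x _; exact: coord_continuous.
- by apply: open_comp => // x _; exact: coord_continuous.
- exact: preimage_subset.
- exact: preimage_subset.
- suff : ((ultralimit ((fun x : npow X n => x i) @^-1` (V `\` F)))%:E
      <= e%:E)%E by [].
  rewrite ultralimit_cylinder; last exact: measurableD.
  by rewrite fineK// fin_num_measure//; exact: measurableD.
Qed.

Lemma regular_boxes : boxes `<=` regular_sets ultralimit_content.
Proof.
move=> _ [A mA <-]; rewrite boxE.
apply: (@fin_bigcap_measurable _ (regular_type ultralimit_content)).
  exact: finite_finset.
by move=> i _; exact: regular_cylinder.
Qed.

(** The regular sets contain the boxes, so the extension of the content is defined on all Borel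
    sets. On open sets, countable unions of regular boxes, only an inequality remains. *)
Lemma ultralimit_probability : exists gamma : probability (borel (npow X n)) R,
  (forall B, boxes B -> gamma B = (ultralimit B)%:E) /\
  (forall V : set (npow X n), open V -> (gamma V <= (ultralimit V)%:E)%E).
Proof.
have [m mL] := regular_content_extension ultralimit_content.
pose S : measurableType _ := g_sigma_algebraType (regular_sets ultralimit_content).
(* Pushing forward along the identity restricts the extension to the Borel sets. *)
have mid : measurable_fun [set: S] (id : S -> borel (npow X n)).
  move=> _ A mA; rewrite setTI preimage_id.
  move: A mA; apply: smallest_sub; first exact: smallest_sigma_algebra.
  by apply: (sub_sigma_boxes_open dX sepX); exact: regular_boxes.
pose fid : {mfun S >-> borel (npow X n)} := mfun_Sub (mem_set mid).
have m1 : m setT = 1%E.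
  by rewrite mL/= ?ultralimit_setT//; apply: regular_boxes; exact: boxesT.
pose pm := probability_of_measure m1.
pose gamma : probability (borel (npow X n)) R := distribution pm fid.
exists gamma; split.
  by move=> B /regular_boxes; exact: mL.
move=> V oV; suff : (m V <= (ultralimit V)%:E)%E by [].
have [D [W [oW VE]]] := open_bigcup_box dX sepX oV.
rewrite {}VE bigcup_mkcond.
apply: (@regular_extension_bigcup_le _ _ ultralimit_content m mL) => k.
case: ifPn => _; last exact: regular_set0.
apply: regular_boxes; exists (W k) => // i.
by apply: measurable_open; exact: oW.
Qed.

End coupling_limit.

(** * Invariant solutions *)

Section symmetric_solutions.
Context {R : realType} {X : ptopologicalType} {n : nat} (d : X -> X -> R).
Hypotheses (dX : metrizes d) (cX : complete_metric d).
Hypothesis sepX : separable_space X.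
Variable mu : probability (borel X) R.
Variable c : npow X n -> \bar R.
Hypotheses (c_ge0 : forall x, (0 <= c x)%E) (c_lsc : lower_semicontinuous c).
Hypothesis c_meas : measurable_fun [set: borel (npow X n)]
  (c : borel (npow X n) -> \bar R).

Definition cylinder (i : 'I_n) (A : set X) : set (npow X n) :=
  (fun x => x i) @^-1` A.

(** The common features of diagonal maps and coordinate permutations. The condition on boxes lets
    invariance be read off where [gamma] equals the limit content; the one on cylinders keeps
    couplings couplings, with [j] different from [i] when coordinates are permuted. *)
Record cost_symmetry (f : npow X n -> npow X n) : Prop := CostSymmetry {
  symmetry_measurable : measurable_fun [set: borel (npow X n)]
    (f : borel (npow X n) -> borel (npow X n));
  symmetry_boxes : forall B, boxes B -> boxes (f @^-1` B);
  symmetry_cylinder : forall i A, measurable (A : set (borel X)) ->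
    exists j (A' : set X), [/\ measurable (A' : set (borel X)), mu A' = mu A &
      f @^-1` cylinder i A = cylinder j A'];
  symmetry_cost : c \o f = c }.

Variable H : set (npow X n -> npow X n).
Hypothesis H_symmetry : forall f, H f -> cost_symmetry f.
Hypothesis H_comm : forall f g, H f -> H g -> f \o g = g \o f.

Lemma couplingP (p : probability (borel (npow X n)) R) : couplings mu p <->
  forall i A, measurable (A : set (borel X)) -> p (cylinder i A) = mu A.
Proof. by []. Qed.

(** The push-forward of [mu] along the diagonal is a coupling. *)
Lemma couplings_nonempty : @couplings R X n mu !=set0.
Proof.
have mdiag : measurable_fun [set: borel X]
    ((fun x _ => x) : borel X -> borel (npow X n)).
  move=> _ A mA; rewrite setTI.
  exact: (@sigma_open_preimage X (npow X n) _ A (@diagonal_continuous X n)).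
pose f : {mfun borel X >-> borel (npow X n)} := mfun_Sub (mem_set mdiag).
exists (distribution mu f); apply/couplingP => i A mA.
by [].
Qed.

(** Averaging over one symmetry after another: a long enough average handles [f], and commutation
    preserves what was gained for the others. Marginals and cost stay the same. *)
Lemma quasi_invariant_coupling (p0 : probability (borel (npow X n)) R)
    (fs : seq (npow X n -> npow X n)) (e : R) : 0 < e -> couplings mu p0 ->
  (forall f, f \in fs -> H f) ->
  exists p : probability (borel (npow X n)) R,
    [/\ couplings mu p, MK_cost c p = MK_cost c p0 &
      forall f, f \in fs -> quasi_invariant e p f].
Proof.
move=> e0 p0mu; elim: fs => [|f fs IH] fsH; first by exists p0.
have [g gfs|p [pmu pc pfs]] := IH; first by apply: fsH; rewrite inE gfs orbT.
have Hf : H f by apply: fsH; rewrite mem_head.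
have [mf _ fcyl fc] := H_symmetry Hf.
near \oo => N.
have [q [qf qg qA qc]] := cesaro_average p N mf.
exists q; split.
- apply/couplingP => i A mA; apply: qA => k.
  (* Every iterate of [f] pulls a cylinder back to a cylinder with the same [mu]-mass, so all terms
     of the average coincide. *)
  suff [j [A' [mA' <- ->]]] : exists j (A' : set X),
      [/\ measurable (A' : set (borel X)), mu A' = mu A &
       iter k f @^-1` cylinder i A = cylinder j A'] by exact: pmu.
  elim: k => [|k [j [A' [mA' A'A E]]]]; first by exists i, A.
  have [j' [B [mB BA' EB]]] := fcyl j A' mA'.
  exists j', B; split => //; first by rewrite BA'.
  rewrite -EB -E; apply/seteqP; split=> x /=; by rewrite -iterSr.
- by rewrite -pc; exact: qc.
- move=> g; rewrite inE => /orP[/eqP ->|gfs].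
    move=> A mA; apply: le_trans (qf A mA) _; apply/ltW; near: N.
    exact: (near_infty_natSinv_lt (PosNum e0)).
  have Hg : H g by apply: fsH; rewrite inE gfs orbT.
  apply: qg; [exact: (symmetry_measurable (H_symmetry Hg))|exact: H_comm|].
  exact: pfs.
Unshelve. all: by end_near. Qed.

Definition near_solutions (fs : seq (npow X n -> npow X n)) (e : R)
    (t : \bar R) : set (probability (borel (npow X n)) R) :=
  [set p | [/\ couplings mu p, (MK_cost c p <= t)%E &
    forall f, f \in fs -> quasi_invariant e p f]].

(* The bound [+oo] is always admitted because the value of the problem may be
   infinite. *)
Definition near_solution_index :
    set (seq (npow X n -> npow X n) * R * \bar R) :=
  [set i | [/\ forall f, f \in i.1.1 -> H f, 0 < i.1.2 &
    (MK_value mu c < i.2)%E \/ i.2 = +oo%E]].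

Definition near_solution_filter :
    set_system (probability (borel (npow X n)) R) :=
  filter_from near_solution_index (fun i => near_solutions i.1.1 i.1.2 i.2).

Lemma near_solutions_nonempty fs e t :
  near_solution_index (fs, e, t) -> near_solutions fs e t !=set0.
Proof.
move=> [/= fsH e0 tv].
have [p0 p0mu p0t] : exists2 p0 : probability (borel (npow X n)) R,
    couplings mu p0 & (MK_cost c p0 <= t)%E.
  case: tv => [/ereal_inf_lt[_ [p0 p0mu <-] /ltW p0t]|->]; first by exists p0.
  by have [p0 p0mu] := couplings_nonempty; exists p0 => //; rewrite leey.
have [p [pmu pc pfs]] := quasi_invariant_coupling e0 p0mu fsH.
by exists p; split => //; rewrite pc.
Qed.

Lemma near_solution_filter_proper : ProperFilter near_solution_filter.
Proof.
apply: filter_from_proper; last by move=> [[fs e] t]; exact: near_solutions_nonempty.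
apply: filter_from_filter; first by exists ([::], 1, +oo%E); split => //; right.
move=> [[fs e] t] [[gs e'] t'] [/= fsH e0 vt] [/= gsH e'0 vt'].
exists (fs ++ gs, Num.min e e', Order.min t t') => /=.
  split => /=.
  - by move=> f; rewrite mem_cat => /orP[/fsH|/gsH].
  - by rewrite lt_min e0.
  - case: vt => [vt|->]; last by rewrite minye.
    case: vt' => [vt'|->]; last by rewrite miney; left.
    by left; rewrite lt_min vt.
move=> p [pmu]; rewrite le_min => /andP[pt pt'] pq; split; split => //.
  move=> f ffs A mA; have := pq f _ A mA; rewrite mem_cat ffs => /(_ isT).
  by rewrite le_min => /andP[].
move=> f fgs A mA; have := pq f _ A mA; rewrite mem_cat fgs orbT => /(_ isT).
by rewrite le_min => /andP[].
Qed.

Theorem symmetric_solution : exists gamma : probability (borel (npow X n)) R,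
  MK_solution mu c gamma /\ forall f, H f -> invariant_under gamma f.
Proof.
have [U [UU FU]] := ultraFilterLemma near_solution_filter_proper.
have UI i : near_solution_index i -> U (near_solutions i.1.1 i.1.2 i.2).
  by move=> Di; apply: FU; exists i.
(* The empty list and the bound +oo ask for nothing but being a coupling. *)
have Umu : U (couplings mu).
  apply: filterS (UI ([::], 1, +oo%E) _) => [p []//|].
  by split => //; right.
have [gamma [gammaB gammaV]] := ultralimit_probability dX cX sepX UU Umu.
have mbox B : boxes B -> measurable (B : set (borel (npow X n))).
  by move=> [A mA <-]; exact: measurable_box.
have gmu : couplings mu gamma.
  apply/couplingP => i A mA.
  have cylE : cylinder i A = box (fun j => if j == i then A else setT).
    apply/seteqP; split=> x /=; last by move=> /(_ i); rewrite eqxx.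
    by move=> Axi j; case: eqP => [->|].
  rewrite gammaB; last first.
    rewrite cylE; exists (fun j => if j == i then A else setT) => // j.
    by case: ifP => // _; exact: (@measurableT _ (borel X)).
  by rewrite (ultralimit_cylinder UU Umu)// fineK// fin_num_measure.
have gcost t : (MK_value mu c < t)%E -> (MK_cost c gamma <= t)%E.
  move=> vt; apply: (@integral_le_of_superlevels _ (borel (npow X n)) R c
    c_ge0 c_meas gamma U t); last first.
    apply: filterS (UI ([::], 1, t) _) => [p []//|].
    by split => //; left.
  (* Superlevel sets are open, so [gamma] is bounded there by the limit content, which is within [e]
     of [p] for [U]-almost every [p]. *)
  move=> a e e0.
  have oS : open (@superlevel _ (borel (npow X n)) R c a : set (npow X n)).
    by have /lower_semicontinuousP := c_lsc; exact.
  have mS := @measurable_superlevel _ (borel (npow X n)) R c c_meas a.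
  have := @ultralimit_cvg _ _ _ U UU _ mS.
  move=> /cvgrPdist_lt /(_ _ e0); apply: filterS => p /=.
  move=> Sp; apply: le_trans (gammaV _ oS) _.
  rewrite -[p _]fineK ?fin_num_measure// -EFinD lee_fin.
  by move: Sp; rewrite ltr_norml => /andP[]; lra.
exists gamma; split; last first.
  move=> f Hf; have [mf fB _ _] := H_symmetry Hf.
  pose mfunf : {mfun borel (npow X n) >-> borel (npow X n)} :=
    mfun_Sub (mem_set mf).
  (* Boxes determine both measures. There [gamma] is the limit content, which inherits
     [e]-invariance for every [e] from the members of [U]. *)
  apply: (@borel_npow_measure_unique _ _ _ _ dX sepX (distribution gamma mfunf)).
  move=> B bB; suff : gamma (f @^-1` B) = gamma B by [].
  rewrite !gammaB//; last exact: fB.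
  congr EFin; apply/eqP; rewrite -subr_eq0 -normr_le0.
  apply/ler_addgt0Pr => e e0; rewrite add0r.
  have cB : `|fine (p (f @^-1` B)) - fine (p B)| @[p --> U] -->
      `|ultralimit U (f @^-1` B) - ultralimit U B|.
    by apply: cvg_norm; apply: cvgB; apply: ultralimit_cvg; apply: mbox => //;
      exact: fB.
  apply: (@closed_cvg _ R U _ _ [set x : R | x <= e] (@closed_le R e) _ _ cB).
  apply: filterS (UI ([:: f], e, +oo%E) _) => [p [_ _ pf]|].
    by apply: pf; [rewrite inE|exact: mbox].
  by split => //= [g|]; [rewrite inE => /eqP ->|right].
split => //; apply/eqP; rewrite eq_le; apply/andP; split; last first.
  by apply: ereal_inf_lbound; exists gamma.
(* Nonnegativity excludes the value -oo. A finite value [v] is approached by the bounds [v + e], and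
   for +oo there is nothing to show. *)
have : (0 <= MK_value mu c)%E.
  apply: le_ereal_inf_tmp => _ [p _ <-]; exact: integral_ge0.
case: (MK_value mu c) gcost => [v gcost _|_ _|//]; last by rewrite leey.
by apply/lee_addgt0Pr => e e0; apply: gcost; rewrite -EFinD lte_fin ltrDl.
Qed.

End symmetric_solutions.

(** * Diagonal maps and coordinate permutations as symmetries *)

Section generators.
Context {R : realType} {X : ptopologicalType} {n : nat}.
Variables (mu : probability (borel X) R) (c : npow X n -> \bar R).

Lemma diag_map_symmetry (d : X -> X -> R) (U : X -> X) :
  metrizes d -> separable_space X ->
  measure_preserving mu (U : borel X -> borel X) ->
  (forall x, c x = c (diag_map U x)) -> cost_symmetry mu c (diag_map U).
Proof.
move=> dX sepX [mU Umu] cU; split.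
- exact: (measurable_diag_map dX sepX mU).
- move=> _ [A mA <-]; exists (fun i => U @^-1` A i) => // i.
  exact: (@measurable_preimage _ (borel X) U (A i) mU (mA i)).
- move=> i A mA; exists i, (U @^-1` A); split => //; last exact: (Umu A mA).
  exact: (@measurable_preimage _ (borel X) U A mU mA).
- by apply/funext => x /=; rewrite -cU.
Qed.

Lemma perm_coord_symmetry (s : {perm 'I_n}) :
  c \o perm_coord s = c -> cost_symmetry mu c (perm_coord s).
Proof.
move=> cs; split => //.
- move=> _ A mA; rewrite setTI.
  exact: (@sigma_open_preimage (npow X n) (npow X n) _ A
    (@perm_coord_continuous X n s)).
(* The side at [i] constrains the coordinate [s i], hence the inverse permutation. *)
- move=> _ [A mA <-]; exists (fun i => A ((s^-1)%g i)) => [i|]; first exact: mA.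
  apply/seteqP; split=> x Ax i; first by have := Ax (s i); rewrite permK.
  by have := Ax ((s^-1)%g i); rewrite /perm_coord permKV.
- by move=> i A mA; exists (s i), A; split.
Qed.

End generators.

Theorem corollary1p8 (R : realType) (X : ptopologicalType)
    (X_polish : polish R X) (mu : probability (borel X) R)
    (n : nat) (c : npow X n -> \bar R)
    (c_ge0 : forall x, (0 <= c x)%E)
    (c_lsc : lower_semicontinuous c)
    (c_meas : measurable_fun [set: borel (npow X n)]
                (c : borel (npow X n) -> \bar R))
    (G : set (X -> X))
    (G_preserving : forall U, G U ->
       measure_preserving mu (U : borel X -> borel X))
    (G_cost : forall U, G U -> forall x, c x = c (diag_map U x))
    (G_comm : forall U V, G U -> G V -> U \o V = V \o U)
    (s : {perm 'I_n})
    (s_cost : c \o perm_coord s = c) :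
  let invariant_solution :=
    exists gamma : probability (borel (npow X n)) R,
      [/\ MK_solution mu c gamma,
          invariant_under gamma (perm_coord s) &
          forall U, G U -> invariant_under gamma (diag_map U)] in
  (countable G -> invariant_solution) /\
  (forall d : X -> X -> R, metrizes d -> ptws_separable G ->
     invariant_solution).
Proof.
move=> invariant_solution; suff : invariant_solution by [].
have [sepX [d dX cX]] := X_polish.
pose H : set (npow X n -> npow X n) :=
  [set perm_coord s] `|` [set diag_map U | U in G].
have H_symmetry f : H f -> cost_symmetry mu c f.
  move=> [->|[U GU <-]]; first exact: perm_coord_symmetry.
  by apply: (diag_map_symmetry dX sepX); [exact: G_preserving|exact: G_cost].
have H_comm f g : H f -> H g -> f \o g = g \o f.
  (* The permutation commutes with diagonal maps by computation, which leaves two diagonal maps. *)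
  move=> [->|[U GU <-]] [->|[V GV <-]] //.
  apply/funext => x; apply/funext => i.
  exact: (congr1 (@^~ (x i)) (G_comm _ _ GU GV)).
have [gamma [gamma_sol gammaH]] :=
  symmetric_solution dX cX sepX c_ge0 c_lsc c_meas H_symmetry H_comm.
exists gamma; split => // [|U GU]; apply: gammaH; first by left.
by right; exists U.
Qed.
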